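(* Let $(X,d)$ be a metric space, let $T:X\rightarrow CB(X)$ be a multivalued integral \'{C}iri\'{c} type $F_{C}$-contraction with $x_{0}\in X$, and let $$r=\inf \left\{ H(Tx,\{x\}): x\in X,\ H(Tx,\{x\})>0\right\}.$$ If $D(x_{0},Tx)=r$ for all $x\in C_{x_{0},r}$, then the circle $C_{x_{0},r}$ is a fixed circle of $T$.
   Context: For a metric space $(X,d)$, $CB(X)$ is the family of all nonempty, closed and bounded subsets of $X$. For $x\in X$ and $B\in CB(X)$, $D(x,B)=\inf\{d(x,y):y\in B\}$, and for $A,B\in CB(X)$, $H(A,B)=\max\{\sup_{x\in A}D(x,B),\sup_{y\in B}D(y,A)\}$ is the Hausdorff metric induced by $d$. The circle is $C_{x_{0},r}=\{x\in X:d(x,x_{0})=r\}$. A circle $C_{x_{0},r}$ is a fixed circle of $T:X\to CB(X)$ if $x\in Tx$ for each $x\in C_{x_{0},r}$. $\mathcal{F}$ is the family of all functions $F:(0,\infty)\to\mathbb{R}$ such that: (F1) $F$ is strictly increasing; (F2) for each sequence $\{\alpha_n\}$ in $(0,\infty)$, $\lim_{n\to\infty}\alpha_n=0$ if and only if $\lim_{n\to\infty}F(\alpha_n)=-\infty$; (F3) there exists $k\in(0,1)$ with $\lim_{\alpha\to0^+}\alpha^kF(\alpha)=0$. For $x,y\in X$ put $M(x,y)=\max\left\{d(x,y),D(x,Tx),D(y,Ty),\tfrac12[D(x,Ty)+D(y,Tx)]\right\}$. Let $\varphi:[0,\infty)\to[0,\infty)$ be a (non-negative) Lebesgue-integrable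 mapping which is summable (has finite integral) on each compact subset of $[0,\infty)$ and satisfies $\int_0^\varepsilon\varphi(t)\,dt>0$ for each $\varepsilon>0$. $T:X\to CB(X)$ is a multivalued integral \'{C}iri\'{c} type $F_{C}$-contraction with $x_0\in X$ if there exist $F\in\mathcal{F}$ and $\tau>0$ such that for all $x\in X$: $H(Tx,\{x\})>0$ implies $\tau+F\left(\int_0^{H(Tx,\{x\})}\varphi(t)\,dt\right)\leq F\left(\int_0^{M(x,x_{0})}\varphi(t)\,dt\right)$. Since $F$ is defined only on $(0,\infty)$, the inequality is understood to include the requirement that its right-hand side is defined, i.e. $M(x,x_0)>0$. *)

(* Defs.v *)
From HB Require Import structures.
From mathcomp Require Import all_boot all_order all_algebra.
From mathcomp Require Import all_classical all_reals all_analysis.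

Set Implicit Arguments.
Unset Strict Implicit.
Unset Printing Implicit Defensive.

Import Order.TTheory GRing.Theory Num.Theory.
Import numFieldNormedType.Exports.

Local Open Scope classical_set_scope.
Local Open Scope ring_scope.

(* Suprema and infima are real-valued (reals.sup, reals.inf), and are 0 by
   convention on the empty set and on sets that are not bounded on the relevant
   side. pdist and hausdorff are therefore the usual quantities for nonempty
   bounded arguments, such as elements of CB and singletons. *)
Section Hausdorff.
Context {R : realType} {X : metricType R}.

Definition CB : set (set X) :=
  [set A | [/\ A !=set0, closed A &
    exists m : R, forall x y, A x -> A y -> mdist x y <= m]].

Definition pdist (x : X) (B : set X) : R := inf [set mdist x y | y in B].

Definition hausdorff (A B : set X) : R :=
  Num.max (sup [set pdist x B | x in A]) (sup [set pdist y A | y in B]).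

Definition circle (x0 : X) (r : R) : set X := [set x | mdist x x0 = r].

Definition fixed_circle (T : X -> set X) (x0 : X) (r : R) : Prop :=
  forall x, circle x0 r x -> T x x.

Definition ciricM (T : X -> set X) (x y : X) : R :=
  Num.max (mdist x y)
    (Num.max (pdist x (T x))
      (Num.max (pdist y (T y)) (2^-1 * (pdist x (T y) + pdist y (T x))))).

End Hausdorff.

Section Contraction.
Context {R : realType}.

(* A function (0, +oo) -> R is represented by a total F : R -> R of which only
   the values at positive reals are constrained or used. *)
Definition wardowski (F : R -> R) : Prop :=
  [/\ forall a b : R, 0 < a -> a < b -> F a < F b,
      forall u : nat -> R, (forall n, 0 < u n) ->
        (u n @[n --> \oo] --> (0 : R)) <-> (F (u n) @[n --> \oo] --> -oo) &
      exists k : R, [/\ 0 < k, k < 1 &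
        a `^ k * F a @[a --> (0 : R)^'+] --> (0 : R)]].

(* Measurability and integrals refer to the Lebesgue sigma-algebra: the library's
   lebesgue_measure only lives on the Borel sets. *)
Definition weight_integral (phi : R -> R) (a : R) : R :=
  \int[completed_lebesgue_measure]_(t in `[0, a]) phi t.

Definition integral_weight (phi : R -> R) : Prop :=
  [/\ forall t, 0 <= t -> 0 <= phi t,
      forall K : set R, compact K -> K `<=` `[0, +oo[ ->
        (@completed_lebesgue_measure R).-integrable K (EFin \o phi) &
      forall e, 0 < e -> 0 < weight_integral phi e].

(* F is meaningful on positive reals only, so the inequality carries the
   requirement 0 < ciricM T x x0. *)
Definition integral_ciric_FC_contraction {X : metricType R} (phi : R -> R)
    (T : X -> set X) (x0 : X) : Prop :=
  exists F : R -> R, wardowski F /\ exists tau : R, 0 < tau /\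
    forall x, 0 < hausdorff (T x) [set x] ->
      0 < ciricM T x x0 /\
      tau + F (weight_integral phi (hausdorff (T x) [set x]))
        <= F (weight_integral phi (ciricM T x x0)).

End Contraction.

(* Main.v *)
(* At [x0] every term of [ciricM] is at most [hausdorff (T x0) [set x0]], so
   strict monotonicity of [F] forces [T x0 = {x0}]. At a point [x] of the circle
   with [hausdorff (T x) [set x] > 0], the terms of [ciricM T x x0] other than
   [pdist x (T x)] then reduce to [r], and [r] is at most that distance by the
   definition of the infimum, which gives the same contradiction. *)
Require Import Defs.
From HB Require Import structures.
From mathcomp Require Import all_boot all_order all_algebra.
From mathcomp Require Import all_classical all_reals all_analysis.
From mathcomp Require Import lra.

Set Implicit Arguments.
Unset Strict Implicit.
Unset Printing Implicit Defensive.

Import Order.TTheory GRing.Theory Num.Theory.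
Import numFieldNormedType.Exports.

Local Open Scope classical_set_scope.
Local Open Scope ring_scope.

Section Hausdorff.
Context {R : realType} {X : metricType R}.
Implicit Types (x y : X) (A B : set X) (T : X -> set X).

Lemma pdist_set1 x y : pdist x [set y] = mdist x y.
Proof. by rewrite /pdist image_set1 inf1. Qed.

Lemma hausdorff_set1E A x :
  hausdorff A [set x] = Num.max (sup [set mdist y x | y in A]) (pdist x A).
Proof.
rewrite /hausdorff image_set1 sup1; congr (Num.max (sup _) _).
by apply: eq_imagel => y _; rewrite pdist_set1.
Qed.

Lemma pdist_le_hausdorff A x : pdist x A <= hausdorff A [set x].
Proof. by rewrite hausdorff_set1E le_max lexx orbT. Qed.

(** Boundedness of [A] makes the supremum of the distances to [x] a genuine upper bound, so each
    point of [A] is at distance 0 from [x]; nonemptiness then puts [x] in [A]. *)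
Lemma CB_set1 A x : CB A -> hausdorff A [set x] <= 0 -> A = [set x].
Proof.
move=> [[a Aa] _ [m Am]]; rewrite hausdorff_set1E ge_max => /andP[supA0 _].
have Ax y : A y -> y = x.
  move=> Ay; apply: (@mdist_positivity R); apply/eqP.
  rewrite eq_le mdist_ge0 andbT; apply: le_trans supA0.
  apply: ub_le_sup; last by exists y.
  (* Triangle inequality through the point [a] of [A]. *)
  exists (m + mdist a x) => _ [z Az <-].
  by apply: (le_trans (metric_triangle _ a _)); rewrite lerD2r Am.
by apply/seteqP; split=> [y /Ax//|_ ->]; rewrite -(Ax a Aa).
Qed.

Lemma pdist_ge0 x A : 0 <= pdist x A.
Proof.
have [->|/set0P[y Ay]] := eqVneq A set0; first by rewrite /pdist image_set0 inf0.
by apply: lb_le_inf; [exists (mdist x y), y|move=> _ [z _ <-]; exact: mdist_ge0].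
Qed.

Lemma ciricM_diag T x : ciricM T x x = pdist x (T x).
Proof.
rewrite /ciricM mdistxx.
have -> : 2^-1 * (pdist x (T x) + pdist x (T x)) = pdist x (T x) by lra.
by rewrite !maxxx; apply/max_idPr; exact: pdist_ge0.
Qed.

End Hausdorff.

Section Weight.
Context {R : realType}.
Implicit Types (phi : R -> R) (a b : R).

(** Nonnegativity of [phi] compares the extended-real integrals; integrability on segments makes
    them finite, so [fine] keeps the order. *)
Lemma weight_integral_le phi a b : integral_weight phi -> a <= b ->
  weight_integral phi a <= weight_integral phi b.
Proof.
move=> [phi0 phiK _] ab; rewrite /weight_integral.
(* Segments are Borel, hence Caratheodory measurable. *)
have m c :
    measurable (`[0, c] : set (caratheodory_type (R:=R) (wlength idfun)^*%mu)).
  by apply: sub_caratheodory; exact: measurable_itv.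
have i c : completed_lebesgue_measure.-integrable `[0, c] (EFin \o phi).
  apply: phiK; first exact: segment_compact.
  by move=> t /=; rewrite !in_itv/= => /andP[->].
apply: fine_le; try exact: integrable_fin_num.
apply: ge0_subset_integral => //.
- by have /integrableP[] := i b.
- by move=> t /=; rewrite in_itv/= lee_fin => /andP[/phi0].
- by move=> t /=; rewrite !in_itv/= => /andP[-> /le_trans->].
Qed.

End Weight.

(** A positive Hausdorff distance dominating [ciricM] would, through the integral and [F],
    contradict [0 < tau]. *)
Lemma contraction_fixed (R : realType) (X : metricType R) (phi : R -> R)
    (T : X -> set X) (x0 x : X) :
  integral_weight phi -> integral_ciric_FC_contraction phi T x0 ->
  CB (T x) ->
  (0 < hausdorff (T x) [set x] ->
    ciricM T x x0 <= hausdorff (T x) [set x]) ->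
  T x = [set x].
Proof.
move=> hphi [F [[Fmono _ _] [tau [tau0 hF]]]] Tx le_M.
apply: CB_set1 => //; rewrite leNgt; apply/negP => H0.
have [M0 FM] := hF _ H0.
have IM0 : 0 < weight_integral phi (ciricM T x x0) by case: hphi => _ _; apply.
have := weight_integral_le hphi (le_M H0).
(* [phi] may vanish between the two bounds, so equal integrals form a separate case. *)
rewrite le_eqVlt => /predU1P[E|/(Fmono _ _ IM0) FH]; last by lra.
by rewrite E in FM; lra.
Qed.

Theorem theorem2p4 (R : realType) (X : metricType R) (phi : R -> R)
    (hphi : integral_weight phi) (T : X -> set X) (hT : forall x, CB (T x))
    (x0 : X) (hTx0 : integral_ciric_FC_contraction phi T x0) (r : R)
    (hr : r = inf [set hausdorff (T x) [set x] |
                   x in [set x | 0 < hausdorff (T x) [set x]]])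
    (hD : forall x, circle x0 r x -> pdist x0 (T x) = r) :
  fixed_circle T x0 r.
Proof.
have Tx0 : T x0 = [set x0].
  apply: (contraction_fixed hphi hTx0) => // _.
  by rewrite ciricM_diag pdist_le_hausdorff.
move=> x xr; suff -> : T x = [set x] by [].
apply: (contraction_fixed hphi hTx0) => // H0.
have rH : r <= hausdorff (T x) [set x].
  (* The set is bounded below by 0 and contains the value at [x] by [H0]. *)
  by rewrite hr; apply: ge_inf; [exists 0 => _ [y /ltW ? <-]|exists x].
have dr : mdist x x0 = r := xr.
have r0 : 0 <= r by rewrite -dr mdist_ge0.
(* Since [T x0] is a singleton, the third term is 0 and, by [hD], the averaged term is
   [2^-1 * (r + r)]. *)
rewrite /ciricM Tx0 !pdist_set1 mdistxx dr hD//.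
rewrite !ge_max rH pdist_le_hausdorff (le_trans r0)//=.
by lra.
Qed.
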